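(* Let $G$ be a strongly topological gyrogroup with a symmetric neighborhood base $\mathscr U$ at $0$ and let $H$ be a locally compact metrizable admissible subgyrogroup of $G$ generated from $\mathscr U$. If the quotient space $G/H$ is sequential, then $G$ is also sequential.
   Context: All topological spaces are assumed to be Hausdorff. A gyrogroup is a set $G$ with a binary operation $\oplus$ such that: (G1) there is a unique identity element $0\in G$ with $0\oplus a=a=a\oplus 0$ for all $a\in G$; (G2) for each $x\in G$ there is a unique inverse $\ominus x\in G$ with $\ominus x\oplus x=0=x\oplus(\ominus x)$; (G3) for all $x,y\in G$ there is an automorphism $\mathrm{gyr}[x,y]$ of $(G,\oplus)$ with $x\oplus(y\oplus z)=(x\oplus y)\oplus \mathrm{gyr}[x,y](z)$ for all $z\in G$; (G4) $\mathrm{gyr}[x\oplus y,y]=\mathrm{gyr}[x,y]$ for all $x,y\in G$. A topological gyrogroup is a gyrogroup with a topology such that $\oplus:G\times G\to G$ is jointly continuous and $x\mapsto\ominus x$ is continuous. A strongly topological gyrogroup with a symmetric neighborhood base $\mathscr U$ at $0$ is a topological gyrogroup $G$ together with a neighborhood base $\mathscr U$ of $0$ such that for every $U\in\mathscr U$: $\ominus U=U$ and $\mathrm{gyr}[x,y](U)=U$ for all $x,y\in G$. A subgyrogroup of $G$ is a nonempty subset $H$ with $\ominus a\in H$ and $a\oplus b\in H$ for all $a,b\in H$; it is an $L$-subgyrogroup if moreover $\mathrm{gyr}[a,h](H)=H$ for all $a\in G$, $h\in H$. A subgyrogroup $H$ of $G$ is an admissible subgyrogroup generated from $\mathscr U$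 if there is a sequence $\{U_n:n\in\omega\}$ of open symmetric neighborhoods of $0$ with each $U_n\in\mathscr U$, $U_{n+1}\oplus(U_{n+1}\oplus U_{n+1})\subset U_n$ for each $n\in\omega$, and $H=\bigcap_{n\in\omega}U_n$. Such an $H$ is known to be a closed $L$-subgyrogroup of $G$. For an $L$-subgyrogroup $H$, the set $G/H=\{a\oplus H:a\in G\}$ is a partition of $G$; it carries the quotient topology with respect to $\pi:G\to G/H$, $\pi(a)=a\oplus H$ (i.e. $O\subset G/H$ is open iff $\pi^{-1}(O)$ is open in $G$). Subsets such as $H$ carry the subspace topology. A subset $A$ of a space $X$ is sequentially closed if no sequence of points of $A$ converges to a point not in $A$. $X$ is sequential if each sequentially closed subset of $X$ is closed. *)

(* Defs.v *)
From HB Require Import structures.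
From mathcomp Require Import all_boot all_order all_algebra.
From mathcomp Require Import all_classical reals topology.

Set Implicit Arguments.
Unset Strict Implicit.
Unset Printing Implicit Defensive.

Local Open Scope classical_set_scope.

(** Gyrogroups *)

Definition is_identity (T : Type) (op : T -> T -> T) (e : T) : Prop :=
  forall a, op e a = a /\ op a e = a.

Definition is_inverse (T : Type) (op : T -> T -> T) (e x y : T) : Prop :=
  op y x = e /\ op x y = e.

Definition is_automorphism (T : Type) (op : T -> T -> T) (f : T -> T) : Prop :=
  bijective f /\ forall a b, f (op a b) = op (f a) (f b).

HB.mixin Record isGyrogroup (G : Type) := {
  gzero : G;
  gadd : G -> G -> G;
  gopp : G -> G;
  gyr : G -> G -> G -> G;
  gzero_identity : is_identity gadd gzero;
  gzero_unique : forall e, is_identity gadd e -> e = gzero;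
  gopp_inverse : forall x, is_inverse gadd gzero x (gopp x);
  gopp_unique : forall x y, is_inverse gadd gzero x y -> y = gopp x;
  gyr_automorphism : forall x y, is_automorphism gadd (gyr x y);
  gyr_assoc : forall x y z,
    gadd x (gadd y z) = gadd (gadd x y) (gyr x y z);
  gyr_loop : forall x y, gyr (gadd x y) y = gyr x y
}.

#[short(type="gyrogroupType")]
HB.structure Definition Gyrogroup := {G of isGyrogroup G}.

Declare Scope gyro_scope.
Delimit Scope gyro_scope with gyro.
Local Open Scope gyro_scope.

Notation "x ⊕ y" := (gadd x y) (at level 50, left associativity) : gyro_scope.
Notation "⊖ x" := (gopp x) (at level 35, right associativity) : gyro_scope.

HB.structure Definition PreTopologicalGyrogroup :=
  {G of Topological G & Gyrogroup G}.

HB.mixin Record PreTopologicalGyrogroup_isTopological G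
    & PreTopologicalGyrogroup G := {
  gadd_continuous : continuous (fun p : G * G => p.1 ⊕ p.2);
  gopp_continuous : continuous (fun x : G => ⊖ x)
}.

#[short(type="topologicalGyrogroupType")]
HB.structure Definition TopologicalGyrogroup :=
  {G of PreTopologicalGyrogroup G & PreTopologicalGyrogroup_isTopological G}.

Section subsets.
Context {G : gyrogroupType}.
Implicit Types A B H : set G.

Definition gadd_set A B : set G := [set a ⊕ b | a in A & b in B].

Definition symmetric_set A : Prop := [set ⊖ a | a in A] = A.

Definition gyr_invariant A : Prop := forall x y : G, gyr x y @` A = A.

Definition subgyrogroup H : Prop :=
  [/\ H !=set0, forall a, H a -> H (⊖ a)
    & forall a b, H a -> H b -> H (a ⊕ b)].

Definition lcoset H (a : G) : set G := [set a ⊕ h | h in H].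

End subsets.

(** The members of [U] are neighborhoods of the identity that need not be
    open. *)
Definition symmetric_nbhs_base (G : topologicalGyrogroupType)
    (U : set (set G)) : Prop :=
  [/\ forall A, U A -> nbhs (gzero : G) A,
      forall B, nbhs (gzero : G) B -> exists2 A, U A & A `<=` B
    & forall A, U A -> symmetric_set A /\ gyr_invariant A].

Definition admissible_from (G : topologicalGyrogroupType)
    (U : set (set G)) (H : set G) : Prop :=
  subgyrogroup H /\
  exists V : nat -> set G,
    [/\ forall n, [/\ U (V n), open_nbhs (gzero : G) (V n)
                    & symmetric_set (V n)],
        forall n, gadd_set (V n.+1) (gadd_set (V n.+1) (V n.+1)) `<=` V n
      & H = \bigcap_n V n].

(** [G/H] as the type of all subsets of [G] of the form [a ⊕ H], made a
    [quotType] by the projection [a |-> a ⊕ H] so that it can be given the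
    library's quotient topology. *)
Definition coset_space (G : gyrogroupType) (H : set G) : Type :=
  set_type (range (lcoset H)).

Section coset_space.
Context {G : gyrogroupType} (H : set G).

Definition coset_pi (a : G) : coset_space H :=
  exist _ (lcoset H a) (mem_set (imageT (lcoset H) a)).

Lemma coset_ex (C : coset_space H) : exists a, lcoset H a = val C.
Proof. by case: (set_valP C) => a _ <-; exists a. Qed.

Definition coset_repr (C : coset_space H) : G := projT1 (cid (coset_ex C)).

Lemma coset_reprK : cancel coset_repr coset_pi.
Proof.
by move=> C; apply: val_inj => /=; rewrite /coset_repr; case: cid.
Qed.

HB.instance Definition _ := isQuotient.Build G (coset_space H) coset_reprK.

End coset_space.

(** Sequential and metrizable spaces *)

Definition sequentially_closed (X : topologicalType) (A : set X) : Prop :=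
  forall (u : nat -> X) (x : X),
    (forall n, A (u n)) -> u @ \oo --> x -> A x.

Definition sequential (X : topologicalType) : Prop :=
  forall A : set X, sequentially_closed A -> closed A.

Definition metrizable (R : realType) (X : topologicalType) : Prop :=
  exists d : X -> X -> R,
    [/\ forall x y, d x y = 0%R <-> x = y,
        forall x y, d x y = d y x,
        forall x y z, (d x z <= d x y + d y z)%R
      & forall (x : X) (A : set X),
          nbhs x A <-> exists2 e : R, (0 < e)%R & [set y | (d x y < e)%R] `<=` A].

(* Main.v *)
Require Import Defs.
From HB Require Import structures.
From mathcomp Require Import all_boot all_order all_algebra.
From mathcomp Require Import all_classical reals topology.

(** After a left translation it is enough to show that a sequentially closed [A]
    with [0] in its closure contains [0]. Otherwise metrizability of [H] yields
    a closed neighborhood [P] of [0] with [P ∩ A ∩ H] empty, and [P] can be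
    taken so small that, [H] being locally compact, the projection restricted to
    [P] behaves like a perfect map. Then [π 0] lies in the closure of
    [π (P ∩ A)] but not in [π (P ∩ A)], so, [G/H] being sequential, some
    [b n ∈ P ∩ A] have [π (b n)] converging to a [π x] outside [π (P ∩ A)]. Every
    subsequence of [b] clusters in the coset [x ⊕ H], and points of [G] are
    G_delta, so a subsequence of [b] converges to a point of this coset; it
    belongs to [P ∩ A], a contradiction. *)

Import Order.TTheory GRing.Theory Num.Theory.

Local Open Scope classical_set_scope.
Local Open Scope gyro_scope.

(** * Cancellation, translations and cosets in gyrogroups *)

Section gyrogroup_theory.
Context {G : gyrogroupType}.
Implicit Types a b x y z : G.

Lemma gadd0g x : gzero ⊕ x = x.
Proof. by case: (@gzero_identity G x). Qed.

Lemma gaddg0 x : x ⊕ gzero = x.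
Proof. by case: (@gzero_identity G x). Qed.

Lemma gaddNg x : ⊖ x ⊕ x = gzero.
Proof. by case: (@gopp_inverse G x). Qed.

Lemma gaddgN x : x ⊕ ⊖ x = gzero.
Proof. by case: (@gopp_inverse G x). Qed.

Lemma gyr_inj a b : injective (gyr a b).
Proof. by case: (@gyr_automorphism G a b) => /bij_inj. Qed.

(** Associativity at [gzero] gives [x ⊕ z = x ⊕ gyr gzero x z]. Left cancellation, which itself
    rests on this lemma, is replaced by adding [⊖ x] on the left and using the injectivity of
    [gyr (⊖ x) x]. *)
Lemma gyr0g x z : gyr gzero x z = z.
Proof.
have gyrNg y : gyr (⊖ x) x y = gyr gzero x y by rewrite -gyr_loop gaddNg.
have e : x ⊕ z = x ⊕ gyr gzero x z by rewrite -[LHS]gadd0g gyr_assoc gadd0g.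
have : ⊖ x ⊕ (x ⊕ z) = ⊖ x ⊕ (x ⊕ gyr gzero x z) by rewrite -e.
by rewrite !gyr_assoc gaddNg !gadd0g !gyrNg => /gyr_inj.
Qed.

Lemma gaddKg x y : ⊖ x ⊕ (x ⊕ y) = y.
Proof. by rewrite gyr_assoc gaddNg gadd0g -gyr_loop gaddNg gyr0g. Qed.

Lemma goppK x : ⊖ (⊖ x) = x.
Proof. by apply/esym/gopp_unique; split; rewrite ?gaddNg ?gaddgN. Qed.

Lemma gaddNKg x y : x ⊕ (⊖ x ⊕ y) = y.
Proof. by rewrite -{1}(goppK x) gaddKg. Qed.

(* The left Bol identity is what makes right translations homeomorphisms. *)
Lemma gadd_bol a b z : a ⊕ (b ⊕ (a ⊕ z)) = (a ⊕ (b ⊕ a)) ⊕ z.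
Proof.
have e : gyr a (b ⊕ a) (gyr b a z) = z.
  (* The loop law applies because [a = ⊖ b ⊕ (b ⊕ a)]; then [gyr (⊖ b) (b ⊕ a)] undoes [gyr b a]. *)
  have -> : gyr a (b ⊕ a) = gyr (⊖ b) (b ⊕ a).
    by rewrite -(gyr_loop (⊖ b)) gaddKg.
  apply: (can_inj (gaddKg a)).
  by have := gyr_assoc (⊖ b) (b ⊕ a) (gyr b a z); rewrite -gyr_assoc !gaddKg.
by rewrite (gyr_assoc b) gyr_assoc e.
Qed.

(* The inverse of the right translation by [x], as given by the Bol identity. *)
Definition gsubr x g : G := ⊖ x ⊕ ((x ⊕ g) ⊕ ⊖ x).

Lemma gsubrK x g : gsubr x g ⊕ x = g.
Proof. by rewrite /gsubr -gadd_bol gaddNg gaddg0 gaddKg. Qed.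

Lemma gaddrK x g : gsubr x (g ⊕ x) = g.
Proof. by rewrite /gsubr -gadd_bol gaddgN gaddg0 gaddKg. Qed.

Lemma gsubrr x : gsubr x x = gzero.
Proof. by rewrite -[in X in gsubr _ X](gadd0g x) gaddrK. Qed.

Section cosets.
Context {H : set G}.
Hypotheses (subH : subgyrogroup H) (gyrH : gyr_invariant H).

Lemma subgyrogroup0 : H gzero.
Proof. by case: subH => -[h Hh] HN HD; rewrite -(gaddNg h); apply/HD/Hh/HN. Qed.

Lemma subgyrogroup_gyr a b h : H h -> H (gyr a b h).
Proof. by move=> Hh; rewrite -(gyrH a b); exists h. Qed.

Lemma lcosetDr a h : H h -> lcoset H (a ⊕ h) = lcoset H a.
Proof.
case: subH => _ HN HD Hh; apply/seteqP; split => [_ [z Hz <-]|_ [k Hk <-]].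
  have [w Hw <-] : (gyr a h @` H) z by rewrite gyrH.
  by exists (h ⊕ w); rewrite ?gyr_assoc//; exact: HD.
exists (gyr a h (⊖ h ⊕ k)); last by rewrite -gyr_assoc gaddNKg.
by apply/subgyrogroup_gyr/HD => //; exact: HN.
Qed.

Lemma lcoset_eq a b : lcoset H a = lcoset H b -> exists2 h, H h & b = a ⊕ h.
Proof.
have : lcoset H b b by exists gzero; [exact: subgyrogroup0|rewrite gaddg0].
by move=> + e; rewrite -e => -[h Hh <-]; exists h.
Qed.

End cosets.
End gyrogroup_theory.

Lemma bigcap_gyr_invariant (G : gyrogroupType) (V : nat -> set G) :
  (forall n, gyr_invariant (V n)) -> gyr_invariant (\bigcap_n V n).
Proof.
move=> gV a b; apply/seteqP; split=> [_ [z Vz <-] n _|z Vz].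
  have <- := gV n a b; exists z => //; exact: Vz.
have : (gyr a b @` V 0%N) z by rewrite gV; exact: Vz.
move=> [w _ wz]; exists w => // n _.
have : (gyr a b @` V n) z by rewrite gV; exact: Vz.
(* Injectivity of the gyration makes the preimages of [z] in the various [V n] coincide. *)
by move=> [w' Vw' w'z]; rewrite (@gyr_inj _ a b w w')// wz w'z.
Qed.

(** * Translations and regularity at the identity *)

Section topological_gyrogroup_theory.
Context {G : topologicalGyrogroupType}.
Implicit Types (x y : G) (N : set G).

Lemma gadd_nbhs x y N : nbhs (x ⊕ y) N -> exists A B : set G,
  [/\ nbhs x A, nbhs y B & forall a b, A a -> B b -> N (a ⊕ b)].
Proof.
move=> /(@gadd_continuous G (x, y))[[A B] /= [Ax By] ABN].
by exists A, B; split=> // a b Aa Bb; exact: (ABN (a, b)).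
Qed.

Lemma gaddr_continuous x : continuous (gadd x : G -> G).
Proof.
move=> y N /gadd_nbhs[A [B [Ax By ABN]]].
by apply: filterS By => b; apply: ABN; exact: nbhs_singleton.
Qed.

Lemma gaddl_continuous y : continuous (fun x : G => x ⊕ y).
Proof.
move=> x N /gadd_nbhs[A [B [Ax By ABN]]].
by apply: filterS Ax => a Aa; apply: ABN => //; exact: nbhs_singleton.
Qed.

Lemma gsubr_continuous x : continuous (gsubr x : G -> G).
Proof.
move=> y N /(@gaddr_continuous (⊖ x)) /(@gaddl_continuous (⊖ x)).
exact: gaddr_continuous.
Qed.

Lemma gsub_nbhs0 N : nbhs (gzero : G) N ->
  exists2 M, nbhs (gzero : G) M & forall a b, M a -> M b -> N (⊖ a ⊕ b).
Proof.
rewrite -[in X in nbhs X _](gaddNg gzero).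
move=> /gadd_nbhs[A [B [A0 B0 ABN]]].
exists ((fun a => ⊖ a) @^-1` A `&` B).
  by apply: filterI => //; exact: gopp_continuous.
by move=> a b [Aa _] [_ Bb]; exact: ABN.
Qed.

(** If [z] is in the closure of [M], some [m] in [M] has the form [w ⊕ z] with [w] in [M], so
    [z = ⊖ w ⊕ m] is in [N]. *)
Lemma closed_nbhs0 N : nbhs (gzero : G) N ->
  exists P, [/\ closed P, nbhs (gzero : G) P & P `<=` N].
Proof.
move=> /gsub_nbhs0[M M0 MN]; exists (closure M); split.
- exact: closed_closure.
- by apply: filterS M0; exact: subset_closure.
- move=> z /(_ (gsubr z @^-1` M)) [|m [Mm Mv]].
    by apply: gsubr_continuous; rewrite gsubrr.
  by rewrite -(gaddKg (gsubr z m) z) gsubrK; exact: MN.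
Qed.

End topological_gyrogroup_theory.

(** * Metric bases, convergent subsequences and cluster points *)

Lemma metrizable_base {R : realType} {X : topologicalType} (x : X) :
  metrizable R X -> exists B : nat -> set X,
    [/\ forall n, nbhs x (B n),
        forall A, nbhs x A -> \forall n \near \oo, B n `<=` A
      & forall y, (forall n, B n y) -> y = x].
Proof.
move=> [d [d0 dC dD dE]].
have small (e : R) : (0 < e)%R -> \forall n \near \oo, (n.+1%:R^-1 < e)%R.
  move=> e0; apply: filterS (nbhs_infty_ger e^-1%R) => n en.
  rewrite invf_plt ?posrE ?ltr0n//.
  by rewrite (le_lt_trans en)// ltr_nat.
exists (fun n => [set y | (d x y < n.+1%:R^-1)%R]); split=> [n|A /dE[e e0 eA]|y Bxy].
- by apply/dE; exists n.+1%:R^-1%R; rewrite ?invr_gt0 ?ltr0n.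
- by apply: filterS (small _ e0) => n ne y /= xy; apply: eA; exact: lt_trans ne.
have dxy_le0 : (d x y <= 0)%R.
  rewrite leNgt; apply/negP => /small[n _ /(_ _ (leqnn n))].
  by rewrite ltNge ltW//; exact: Bxy.
apply/esym/d0/le_anti; rewrite dxy_le0/=.
(* Nonnegativity of [d] comes from [0 = d x x <= d x y + d y x]. *)
by have := dD x y x; rewrite (dC y x) (proj2 (d0 x x) erefl) -mulr2n pmulrn_lge0.
Qed.

Lemma set_type_nbhsP {X : topologicalType} {A : set X} (x : set_type A)
    (B : set (set_type A)) :
  nbhs x B <-> exists2 W, nbhs (set_val x) W & forall y, W (set_val y) -> B y.
Proof.
split=> [[_ [[W oW <-] Wx WB]]|[W Wx WB]].
  by exists W => //; exact: open_nbhs_nbhs.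
move: Wx; rewrite nbhsE => -[W' [oW' W'x] W'W].
exists (set_val @^-1` W'); split; [by exists W'|exact: W'x|].
by move=> y /W'W; exact: WB.
Qed.

(* Subsequences are taken along arbitrary, not necessarily increasing, [s]
   tending to infinity. *)
Lemma cvg_subsequence {T : topologicalType} (b : nat -> T) (q : T)
    (D : nat -> set T) :
  (forall n, closed (D n)) -> (forall n, nbhs q (D n)) ->
  (forall y, (forall n, D n y) -> y = q) ->
  cluster (b @ \oo) q ->
  (forall s : nat -> nat, s @ \oo --> \oo -> cluster (b \o s @ \oo) !=set0) ->
  exists2 s : nat -> nat, s @ \oo --> \oo & b \o s @ \oo --> q.
Proof.
move=> clD nbD Dq bq bcl.
have cofinal (s : nat -> nat) : (forall n, n <= s n)%N -> s @ \oo --> \oo.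
  move=> sn P [N _ NP]; exists N => // n /= Nn; apply: NP => /=.
  exact: leq_trans (sn n).
have cluster_closed (f : nat -> T) r C :
    closed C -> cluster (f @ \oo) r -> (\forall n \near \oo, C (f n)) -> C r.
  by move=> clC fr fC; apply: clC => B rB; exact: fr.
(* [b (s n)] is put in [D 0], ..., [D n] at once, so that each closed [D j] contains a tail of
   [b \o s] and hence its cluster points. *)
have /choice[s sP] n : exists m, (n <= m)%N /\ forall j, (j <= n)%N -> D j (b m).
  have Dn : nbhs q [set y | forall j : 'I_n.+1, D j y].
    by apply: filter_forall => j; exact: nbD.
  have : (b @ \oo) (b @` [set m | (n <= m)%N]) by exists n => // m nm; exists m.
  move=> /bq /(_ Dn)[_ [[m nm <-] Dm]]; exists m; split=> // j jn.
  exact: (Dm (Ordinal (jn : (j < n.+1)%N))).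
have sn n : (n <= s n)%N by case: (sP n).
exists s; first exact: cofinal.
move=> W; rewrite nbhsE => -[W' [oW' W'q] W'W].
suff : \forall n \near \oo, W' (b (s n)) by apply: filterS => n /W'W.
apply: contrapT => W'n.
(* Terms outside [W'] form a further subsequence; its cluster point [r] avoids the open [W'], yet
   lies in every [D j] and so equals [q]. *)
have /choice[t tP] n : exists m, (n <= m)%N /\ ~ W' (b (s m)).
  apply: contrapT => h; apply: W'n; exists n => // m /= nm.
  by apply: contrapT => W'm; apply: h; exists m.
have [|r br] := bcl (s \o t).
  by apply: cofinal => n; rewrite (leq_trans (proj1 (tP n)))/=.
have : (~` W') r.
  apply: (cluster_closed _ _ _ _ br); first exact: open_closedC.
  by apply: nearW => n; case: (tP n).
apply; rewrite (Dq r)// => j.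
apply: (cluster_closed _ _ _ _ br) => //; exists j => // n /= jn.
by apply: (proj2 (sP _)); rewrite (leq_trans jn)//; case: (tP n).
Qed.

(** If no point of [x ⊕ K] were a cluster point, each [k] in [K] would have a neighborhood excluding
    [b n = v ⊕ (x ⊕ k')] for large [n] and [v] near [gzero]; compactness makes this uniform over
    [K]. *)
Lemma gadd_cluster {G : topologicalGyrogroupType} {K : set G} (x : G)
    (b : nat -> G) :
  compact K ->
  (forall Q, nbhs (gzero : G) Q ->
     \forall n \near \oo, exists v k, [/\ Q v, K k & b n = v ⊕ (x ⊕ k)]) ->
  exists2 k, K k & cluster (b @ \oo) (x ⊕ k).
Proof.
move=> /compact_near_coveringP cptK bK; apply: contrapT => ncl.
have [|[N Q] /= [[n0 _ n0N] Q0] NQ] := cptK _ (filter_prod \oo (nbhs (gzero : G)))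
    (fun i k => b i.1 <> i.2 ⊕ (x ⊕ k)) _.
  move=> k Kk; have [E [T [bE Tk ET]]] : exists E T,
      [/\ (b @ \oo) E, nbhs (x ⊕ k) T & ~ (E `&` T !=set0)].
    apply: contrapT => h; apply: ncl; exists k => // E T bE Tk.
    by apply: contrapT => ET; apply: h; exists E, T.
  move: Tk; rewrite -(gadd0g (x ⊕ k)) => /gadd_nbhs[A [B [A0 Bk ABT]]].
  exists (gadd x @^-1` B, (b @^-1` E) `*` A) => /=.
    split; first exact: gaddr_continuous.
    by exists (b @^-1` E, A).
  move=> [k' [n v]] /= [Bk' [En Av]] e; apply: ET; exists (b n); split=> //.
  by rewrite e; exact: ABT.
have [n1 _ n1Q] := bK _ Q0.
have [v [k [Qv Kk e]]] := n1Q (maxn n0 n1) (leq_maxr _ _).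
exact: (NQ (maxn n0 n1, v) (conj (n0N _ (leq_maxl _ _)) Qv) _ Kk).
Qed.

(** * Convergence in the quotient space *)

Section quotient_by_subgyrogroup.
Context {G : topologicalGyrogroupType} {H : set G}.
Hypotheses (subH : subgyrogroup H) (gyrH : gyr_invariant H).
Local Notation pi := (\pi_(quotient_topology (coset_space H)))%qT.

Lemma coset_piE (a b : G) : (pi a = pi b) = (lcoset H a = lcoset H b).
Proof.
rewrite !unlock -[LHS]/(coset_pi H a = coset_pi H b).
by apply/propext; split=> [/(congr1 val)//|e]; exact: val_inj.
Qed.

Lemma coset_pi_cvg (u : nat -> G) (x : G) (W : set G) :
  pi (u n) @[n --> \oo] --> pi x -> nbhs x W ->
  \forall n \near \oo, exists2 h, H h & W (u n ⊕ h).
Proof.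
move=> ux; rewrite nbhsE => -[W' [oW' W'x] W'W].
pose O := [set y | exists2 w, W' w & pi w = y].
have : \forall n \near \oo, O (pi (u n)).
  apply: ux; apply: open_nbhs_nbhs; split; last by exists x.
  rewrite -[open O]/(open (pi @^-1` O)).
  (* [pi] is an open map: the saturation of [W'] is a union of preimages under right translations by
     elements of [H]. *)
  have -> : pi @^-1` O = \bigcup_(h in H) ((fun g : G => g ⊕ h) @^-1` W').
    apply/seteqP; split=> g /=.
      move=> [w W'w]; rewrite coset_piE => /esym/(lcoset_eq subH)[h Hh wE].
      by exists h => //=; rewrite -wE.
    by move=> [h Hh W'gh]; exists (g ⊕ h) => //; rewrite coset_piE lcosetDr.
  apply: bigcup_open => h _.
  by have /continuousP := @gaddl_continuous G h; exact.
apply: filterS => n [w W'w]; rewrite coset_piE => /esym/(lcoset_eq subH)[h Hh wE].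
by exists h => //; apply: W'W; rewrite -wE.
Qed.

(** Brings convergence in the quotient into the form required by [gadd_cluster]: a right factor from
    [H] is traded for a left translation by a small [v]. *)
Lemma coset_pi_cvg_left (u : nat -> G) (x : G) (Q : set G) :
  pi (u n) @[n --> \oo] --> pi x -> nbhs (gzero : G) Q ->
  \forall n \near \oo, exists v k, [/\ Q v, H k & u n = v ⊕ (x ⊕ k)].
Proof.
move=> ux Q0.
have : nbhs x (gsubr x @^-1` Q : set G).
  by apply: gsubr_continuous; rewrite gsubrr.
move=> /(coset_pi_cvg _ _ _ ux); apply: filterS => n [h Hh /= Qv].
set v := gsubr x (u n ⊕ h) in Qv.
(* Since [v ⊕ x = u n ⊕ h], moving [v] to the other side only gyrates [h], which stays in [H]. *)
have e : lcoset H x = lcoset H (⊖ v ⊕ u n).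
  rewrite -(lcosetDr subH gyrH (⊖ v ⊕ u n) _ (subgyrogroup_gyr gyrH (⊖ v) (u n) _ Hh)).
  by rewrite -gyr_assoc -(gsubrK x (u n ⊕ h)) gaddKg.
have [k Hk kE] := lcoset_eq subH _ _ e.
by exists v, k; split; rewrite -?kE ?gaddNKg.
Qed.

End quotient_by_subgyrogroup.

(** [D n] is chosen inside [V n] with its trace on [H] inside the [n]-th ball of [H]: the first puts
    the intersection in [H], the second shrinks it to [gzero]. *)
Lemma nbhs0_countable_bigcap {R : realType} {G : topologicalGyrogroupType}
    {V : nat -> set G} :
  (forall n, nbhs (gzero : G) (V n)) ->
  metrizable R (set_type (\bigcap_n V n)) ->
  exists D : nat -> set G,
    [/\ forall n, closed (D n), forall n, nbhs (gzero : G) (D n)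
      & forall g, (forall n, D n g) -> g = gzero].
Proof.
move=> V0 mH; set H := \bigcap_n V n in mH.
have H0 : H gzero by move=> n _; exact: nbhs_singleton (V0 n).
pose h0 : set_type H := exist _ gzero (mem_set H0).
have [B [B0 _ Bh0]] := metrizable_base h0 mH.
have /choice[D DP] n : exists P, [/\ closed P, nbhs (gzero : G) P &
    P `<=` V n `&` [set g | forall Hg : g \in H, B n (exist _ g Hg)]].
  apply/closed_nbhs0/filterI => //.
  have /set_type_nbhsP[W W0 WB] := B0 n.
  by apply: filterS W0 => g Wg Hg; exact: WB.
exists D; split=> [n|n|g Dg]; [by case: (DP n)|by case: (DP n)|].
have Hg : H g by move=> n _; have [_ _ /(_ _ (Dg n))[]] := DP n.
suff /(congr1 val) : exist _ g (mem_set Hg) = h0 by [].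
by apply: Bh0 => n; have [_ _ /(_ _ (Dg n))[_]] := DP n; exact.
Qed.

(** Otherwise, by first countability of [H], points of [A] in [H] would converge to [x]. *)
Lemma sequentially_closed_nbhs {R : realType} {X : topologicalType}
    {H A : set X} {x : X} :
  metrizable R (set_type H) -> sequentially_closed A -> H x -> ~ A x ->
  exists2 N, nbhs x N & forall h, H h -> N h -> ~ A h.
Proof.
move=> mH clA Hx nAx; pose h0 : set_type H := exist _ x (mem_set Hx).
have [B [B0 BE _]] := metrizable_base h0 mH.
have [n Bn] : exists n, forall h : set_type H, B n h -> ~ A (val h).
  apply: contrapT => nB; apply: nAx.
  have /choice[u uP] n : exists h, B n h /\ A (set_val h).
    apply: contrapT => h; apply: nB; exists n => g Bg Ag.
    by apply: h; exists g.
  apply: (clA (fun n => set_val (u n)) x) => [n|W Wx]; first by case: (uP n).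
  have /BE : nbhs h0 (set_val @^-1` W) by apply/set_type_nbhsP; exists W.
  by apply: filterS => n; apply; case: (uP n).
have /set_type_nbhsP[W Wx WB] := B0 n.
exists W => // h Hh Wh.
exact: (Bn (exist _ h (mem_set Hh)) (WB (exist _ h (mem_set Hh)) Wh)).
Qed.

(** * Lifting convergent sequences from the quotient *)

Section core.
Context {R : realType} {G : topologicalGyrogroupType} {V : nat -> set G}.
Let H := \bigcap_n V n.
Hypotheses (subH : subgyrogroup H) (gyrV : forall n, gyr_invariant (V n)).
Hypothesis V0 : forall n, nbhs (gzero : G) (V n).
Hypothesis lcH : locally_compact [set: set_type H].
Hypothesis mH : metrizable R (set_type H).
Hypothesis seqGH : sequential (quotient_topology (coset_space H)).
Local Notation pi := (\pi_(quotient_topology (coset_space H)))%qT.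

Let gyrH : gyr_invariant H. Proof. exact: bigcap_gyr_invariant. Qed.

(* [M] is so small that the [k] with [b n ∈ M ⊕ (y ⊕ k)] stay in a compact part
   of [H], where [y] is a representative of the limit coset close to [0]. *)
Lemma cluster_in_coset : exists2 M, nbhs (gzero : G) M &
  forall (b : nat -> G) (x : G), (forall n, M (b n)) ->
    pi (b n) @[n --> \oo] --> pi x ->
    exists y, pi y = pi x /\ forall s : nat -> nat, s @ \oo --> \oo ->
      exists2 k, H k & cluster (b \o s @ \oo) (y ⊕ k).
Proof.
have H0 := subgyrogroup0 subH.
pose h0 : set_type H := exist _ gzero (mem_set H0).
have [K K0 [cptK _]] : compact_near (within setT (nbhs h0)) by exact: lcH.
move: K0; rewrite withinET => /set_type_nbhsP[N N0 NK].
have [M1 M10 M1N] := gsub_nbhs0 _ N0.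
have [M M0 MM1] := gsub_nbhs0 _ M10.
exists M => // b x bM bx.
have [n0 _ /(_ _ (leqnn n0))[v0 [k0 [Mv0 Hk0 b0E]]]] :=
  coset_pi_cvg_left subH gyrH _ _ _ bx M0.
(* A single term [b n0 = v0 ⊕ y] supplies a representative [y = ⊖ v0 ⊕ b n0] of the same coset that
   is close to [gzero]. *)
pose y := x ⊕ k0.
have M1y : M1 y by rewrite /y -(gaddKg v0 (x ⊕ k0)) -b0E; exact: MM1.
have xy : pi y = pi x by rewrite coset_piE lcosetDr.
exists y; split => // s soo.
have : pi ((b \o s) n) @[n --> \oo] --> pi y.
  by rewrite xy; exact: (cvg_comp _ _ soo bx).
move=> /(coset_pi_cvg_left subH gyrH) bsy.
have : compact (set_val @` K).
  apply: continuous_compact => //; apply: continuous_subspaceT.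
  exact: initial_continuous.
move=> /gadd_cluster -/(_ y (b \o s))[Q Q0|_ [k Kk <-] bk].
  apply: filterS (bsy _ (filterI Q0 M0)) => n [v [k [[Qv Mv] Hk bE]]].
  (* [k = ⊖ y ⊕ (⊖ v ⊕ b n)], where both [y] and [⊖ v ⊕ b n] lie in [M1]. *)
  have Nk : N k.
    rewrite -(gaddKg y k); apply: M1N => //.
    by rewrite -(gaddKg v (y ⊕ k)) -bE; apply: MM1 => //; exact: bM.
  by exists v, k; split=> //; exists (exist _ k (mem_set Hk)) => //; exact: NK.
by exists (set_val k) => //; exact: set_valP.
Qed.

Lemma sequentially_closed_closure0 (A : set G) :
  sequentially_closed A -> closure A gzero -> A gzero.
Proof.
move=> clA A0; apply: contrapT => nA0.
have H0 := subgyrogroup0 subH.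
have [N N0 NA] := sequentially_closed_nbhs mH clA H0 nA0.
have [M M0 Mcl] := cluster_in_coset.
have [P [clP P0 PMN]] := closed_nbhs0 _ (filterI M0 N0).
pose B : set (quotient_topology (coset_space H)) := pi @` (P `&` A).
have nB0 : ~ B (pi gzero).
  move=> [a [Pa Aa]]; rewrite coset_piE => /esym/(lcoset_eq subH)[h Hh ahE].
  by apply: (NA a) => //; [rewrite ahE gadd0g|case: (PMN _ Pa)].
(* [pi gzero] is in the closure of [B], so [B] is not closed; the contradiction will be that [B] is
   sequentially closed. *)
have : ~ sequentially_closed B.
  move=> /seqGH clB; apply/nB0/clB => W Wpi.
  have W0 : nbhs (gzero : G) (pi @^-1` W) by exact: pi_continuous Wpi.
  have [a [Aa [Wa Pa]]] := A0 _ (filterI W0 P0).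
  by exists (pi a); split => //; exists a.
apply=> u z uB; rewrite -[z]reprK; set x := repr z => ux.
have /choice[b bP] n : exists a, (P `&` A) a /\ pi a = u n.
  by have [a PAa au] := uB n; exists a.
have bx : pi (b n) @[n --> \oo] --> pi x.
  by rewrite (_ : (fun n => pi (b n)) = u)//; apply/funext => n; case: (bP n).
have [|y [yx bcl]] := Mcl b x _ bx.
  by move=> n; have [[/PMN[]]] := bP n.
have [D [clD D0 Dg]] := nbhs0_countable_bigcap V0 mH.
have [k Hk bk] := bcl id cvg_id.
pose q := y ⊕ k.
(* The translates [q ⊕ D n] are closed neighborhoods of [q] meeting only in [q]. *)
have [|||||s soo bsq] := @cvg_subsequence _ b q (fun n => gadd (⊖ q) @^-1` D n).
- by move=> n; apply: preimage_closed => // g _; exact: gaddr_continuous.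
- by move=> n; apply: gaddr_continuous; rewrite gaddNg.
- by move=> g /Dg e; rewrite -(gaddNKg q g) e gaddg0.
- exact: bk.
- by move=> s /bcl[k' _ ?]; exists (y ⊕ k').
exists q; last by rewrite -yx coset_piE lcosetDr.
split; last by apply: clA bsq => n; have [[]] := bP (s n).
apply: (closed_cvg _ clP _ _ bsq); apply: nearW => n.
by have [[]] := bP (s n).
Qed.

End core.

Theorem theorem4p5 (R : realType) (G : topologicalGyrogroupType)
    (U : set (set G)) (H : set G) :
  hausdorff_space G ->
  symmetric_nbhs_base U ->
  admissible_from U H ->
  locally_compact [set: set_type H] ->
  metrizable R (set_type H) ->
  sequential (quotient_topology (coset_space H)) ->
  sequential G.
Proof.
move=> _ [_ _ Uinv] [subH [V [UV _ HE]]]; subst H => lcH mH seqGH A clA x Ax.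
have gyrV n : gyr_invariant (V n) by have [/Uinv[]] := UV n.
have V0 n : nbhs (gzero : G) (V n) by have [_ /open_nbhs_nbhs] := UV n.
rewrite -(gaddg0 x).
apply: (sequentially_closed_closure0 subH gyrV V0 lcH mH seqGH
  (gadd x @^-1` A)).
  move=> u y uA uy; apply: (clA (gadd x \o u)) => //.
  exact: (cvg_comp _ _ uy (@gaddr_continuous _ x y)).
move=> W W0; have xW : nbhs x (gadd (⊖ x) @^-1` W).
  by apply: gaddr_continuous; rewrite gaddNg.
have [a [Aa Wa]] := Ax _ xW.
by exists (⊖ x ⊕ a); split=> //=; rewrite gaddNKg.
Qed.
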